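(* For integers $d,n\ge 1$ and a real number $p\in(1,\infty)\setminus\{2\}$, let $\rho_{\min}(d,n,p)$ be the smallest number in $[0,1]$ such that every measurable set $E\subseteq\mathbb{R}^d$ of upper Banach density $\overline{\rho}(E)>\rho_{\min}(d,n,p)$ contains $\ell^p$-isometric copies of all sufficiently large dilates of every $n$-point configuration. Then, for every $p\in(1,\infty)\setminus\{2\}$, \[ \rho_{\min}(d,n,p)=1-\frac1n+O_d\Big(\frac1{n^2}\Big), \] where the implied constant depends only on $d$.
   Context: For a measurable set $E\subseteq\mathbb{R}^d$, $|E|$ denotes its Lebesgue measure, and its upper Banach density is \[ \overline{\rho}(E):=\lim_{R\to\infty}\sup_{x\in\mathbb{R}^d}\frac{|E\cap(x+[0,R]^d)|}{R^d} \] (the limit always exists). For $x=(x_1,\ldots,x_d)\in\mathbb{R}^d$ write $\|x\|_p:=\big(\sum_{i=1}^d|x_i|^p\big)^{1/p}$. An $n$-point configuration is a set of exactly $n$ points in $\mathbb{R}^d$. For a finite set $P\subseteq\mathbb{R}^d$ and $r\in(0,\infty)$, a set $Y\subseteq\mathbb{R}^d$ is an $\ell^p$-isometric copy of the dilate $rP$ if there exists a bijection $\phi\colon P\to Y$ such that $\|\phi(u)-\phi(v)\|_p=r\|u-v\|_p$ for all $u,v\in P$. ''$E$ contains $\ell^p$-isometric copies of all sufficiently large dilates of every $n$-point configuration'' means: for every $n$-point set $P\subseteq\mathbb{R}^d$ there exists $r_0\in(0,\infty)$ (allowed to depend on $E$ and $P$) such that for every $r\ge r_0$ some $\ell^p$-isometric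 copy $Y$ of $rP$ satisfies $Y\subseteq E$. The notation $f=O_d(g)$ means $|f|\le C_d\,g$ for some constant $C_d$ depending only on $d$. *)

(* Defs.v *)
From HB Require Import structures.
From mathcomp Require Import all_boot all_order all_algebra.
From mathcomp Require Import all_classical all_reals all_analysis.

Set Implicit Arguments.
Unset Strict Implicit.
Unset Printing Implicit Defensive.

Import Order.TTheory GRing.Theory Num.Theory.
Import numFieldNormedType.Exports.

Local Open Scope classical_set_scope.
Local Open Scope ring_scope.

Section LebesgueRd.
Context {R : realType} {d : nat}.
Implicit Types (a b x : 'rV[R]_d) (E : set 'rV[R]_d).

Definition box a b : set 'rV[R]_d :=
  [set x | forall i, x ord0 i \in `]a ord0 i, b ord0 i]].

Definition box_volume a b : R := \prod_(i < d) (b ord0 i - a ord0 i).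

(* The bounds of every box are required to be ordered (possibly equal, so that
   finite covers can be padded with empty boxes when d > 0); otherwise
   box_volume could be negative. *)
Definition box_cover E (a b : nat -> 'rV[R]_d) : Prop :=
  (forall k i, a k ord0 i <= b k ord0 i) /\
  E `<=` \bigcup_k box (a k) (b k).

(* The Lebesgue outer measure on R^d; on Lebesgue measurable sets it is the
   (complete) Lebesgue measure. *)
Definition lebesgue_Rd E : \bar R :=
  ereal_inf [set v | exists a b : nat -> 'rV[R]_d, box_cover E a b /\
    v = (\sum_(0 <= k <oo) (box_volume (a k) (b k))%:E)%E].

Definition lebesgue_measurable E : Prop :=
  caratheodory_measurable lebesgue_Rd E.

Definition cube x (s : R) : set 'rV[R]_d :=
  [set y | forall i, x ord0 i <= y ord0 i <= x ord0 i + s].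

Definition upper_banach_density E : \bar R :=
  lim (ereal_sup [set (lebesgue_Rd (E `&` cube x s) * ((s ^+ d)^-1)%:E)%E
                 | x in [set: 'rV[R]_d]] @[s --> +oo%R]).

End LebesgueRd.

Section Configurations.
Context {R : realType} {d : nat}.
Implicit Types (p r : R) (P Y E : set 'rV[R]_d).

Definition lp_norm p (x : 'rV[R]_d) : R :=
  (\sum_(i < d) `|x ord0 i| `^ p) `^ p^-1.

Definition configuration (n : nat) P : Prop := (P #= `I_n)%card.

(* Only the values of phi on P matter. *)
Definition lp_isometric_copy p r P Y : Prop :=
  exists phi : 'rV[R]_d -> 'rV[R]_d, set_bij P Y phi /\
    forall u v, P u -> P v -> lp_norm p (phi u - phi v) = r * lp_norm p (u - v).

Definition contains_large_dilates (n : nat) p E : Prop :=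
  forall P, configuration n P ->
    exists2 r0 : R, 0 < r0 & forall r, r0 <= r ->
      exists2 Y, lp_isometric_copy p r P Y & Y `<=` E.

End Configurations.

Section Threshold.
Context {R : realType}.

Definition admissible_densities (d n : nat) (p : R) : set R :=
  [set rho | 0 <= rho <= 1 /\
    forall E : set 'rV[R]_d, lebesgue_measurable E ->
      (rho%:E < upper_banach_density E)%E -> contains_large_dilates n p E].

Definition is_rho_min (d n : nat) (p rho : R) : Prop :=
  admissible_densities d n p rho /\ lbound (admissible_densities d n p) rho.

End Threshold.

(* Main.v *)
From HB Require Import structures.
Require Import Defs.
From mathcomp Require Import all_boot all_order all_algebra.
From mathcomp Require Import all_classical all_reals all_analysis.
From mathcomp Require Import measurable_realfun.
From mathcomp Require Import ring lra zify.

(** The threshold exists because the admissible densities form a nonempty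
    subset of [0, 1] that contains its infimum: a set of density above the
    infimum has density above some admissible value ([is_rho_min_inf]).

    Upper bound, 1 - 1/n. Let E have density above 1 - 1/n and let P have n
    points. Translating r P by t fails to land in E only if t lies in one of n
    translates of the complement of E. In a cube that is large compared with
    r P and rich in E, each of these has relative measure below 1/n, so they
    cannot cover the cube ([dense_translate]). Every r works, and the copy found
    is a translate of r P.

    Lower bound, 1 - 1/m with m = n - 2(d - 1). For p different from 2 the space
    l^p is rigid. The configuration P consists of the vectors e_i and - e_i
    together with the progression - e_0, 0, e_0, ..., (m - 2) e_0. If phi carries P
    onto an l^p-isometric copy of r P then
    - equality in the triangle inequality, with strict convexity, makes phi
      carry three equally spaced collinear points to three such points
      ([lp_copy_affine]), so phi (- e_i) is opposite to phi (e_i) with respect to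
      phi (0), and the progression goes to a progression;
    - the vectors phi (e_i) - phi (0) then satisfy pairwise the p-th power
      parallelogram identity, which for p different from 2 forces disjoint
      supports ([lp_mass_disjoint]). There are d of them in dimension d, so each
      lies on a coordinate axis ([lp_copy_axis]).
    Hence the progression goes to a progression along an axis with step r or - r.
    Let E be the set of points whose coordinates, rounded up, have a sum not
    divisible by m. Along an axis an integral step r = 1 modulo m changes this
    sum by 1 or - 1 modulo m, so m consecutive terms meet the complement of E:
    no copy of r P lies in E ([stripeC_avoids_rigid]). The m translates of the
    complement of E by 0, e_0, ..., (m - 1) e_0 partition the space, so E has
    density 1 - 1/m ([upper_banach_density_stripeC]). Finally 1/m - 1/n is
    O(d / n^2) once n > 4d, and smaller n are absorbed by the constant,
    uniformly in p.

    The measure theory needed is that the outer measure built from covers by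
    boxes is an outer measure, gives boxes their volume, and makes half-spaces
    bounded by coordinate hyperplanes measurable. The lower bound for the measure
    of a box integrates the inequality between indicator functions one coordinate
    at a time on the real line ([box_volume_le_cover]). *)

Set Implicit Arguments.
Unset Strict Implicit.
Unset Printing Implicit Defensive.

Import Order.TTheory GRing.Theory Num.Theory.
Import numFieldNormedType.Exports.
Local Open Scope classical_set_scope.
Local Open Scope ring_scope.

(** * Strict inequalities for real powers *)

(** For x = e^y with y nonzero, the claim combines the bound 1 + t <= e^t at
    t = (p - 1) y, where it is strict, with the same bound at t = - y. *)
Lemma bernoulli_powR_strict (R : realType) (p x : R) : 1 < p -> 0 <= x -> x != 1 ->
  1 + p * (x - 1) < x `^ p.
Proof.
move=> p1; rewrite le_eqVlt => /predU1P[<- _|x0 x1].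
  rewrite powR0; last by lra.
  by lra.
have y0 : ln x != 0 by rewrite ln_eq0.
rewrite /powR gt_eqF//; set y := ln x in y0 *.
have -> : x = expR y by rewrite lnK// posrE.
have h1 : 1 + (p - 1) * y < expR ((p - 1) * y).
  by apply: expR_gt1Dx; rewrite mulf_neq0// subr_eq0 gt_eqF.
have h2 : expR y - 1 <= expR y * y.
  have := expR_ge1Dx (- y); rewrite expRN => h.
  have e0 := expR_gt0 y.
  have : expR y * (1 - y) <= 1.
    by rewrite -[leRHS](mulfV (lt0r_neq0 e0)) ler_pM2l.
  by lra.
have -> : p * y = y + (p - 1) * y by ring.
rewrite expRD; have e0 := expR_gt0 y.
have : expR y * (1 + (p - 1) * y) < expR y * expR ((p - 1) * y) by rewrite ltr_pM2l.
nra.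
Qed.

Lemma powR_rescale (R : realType) (p c x : R) : 0 < c -> 0 <= x ->
  x `^ p = c `^ p * (x / c) `^ p.
Proof.
move=> c0 x0; rewrite -powRM ?(ltW c0) ?divr_ge0 ?(ltW c0)//.
by rewrite mulrCA divff ?mulr1// gt_eqF.
Qed.

(** The tangent to t^p at the midpoint lies strictly below the graph at both ends,
    by the strict Bernoulli inequality, and averages to its value there. *)
Lemma powR_midpoint_strict (R : realType) (p a b : R) :
  1 < p -> 0 <= a -> 0 <= b -> a != b ->
  2 * ((a + b) / 2) `^ p < a `^ p + b `^ p.
Proof.
move=> p1 a0 b0 ab; set c := (a + b) / 2.
have c0 : 0 < c.
  rewrite lt_neqAle; apply/andP; split; last by rewrite /c; lra.
  by apply/eqP => /esym; move/eqP: ab; rewrite /c; lra.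
have tangent x : 0 <= x -> x != c -> c `^ p * (1 + p * (x / c - 1)) < x `^ p.
  move=> x0 xc; have -> : x `^ p = c `^ p * (x / c) `^ p.
    exact: powR_rescale.
  rewrite ltr_pM2l ?powR_gt0//; apply: bernoulli_powR_strict => //.
    exact: divr_ge0 x0 (ltW c0).
  by apply: contra_neq xc => /divr1_eq.
have ac : a != c by apply: contra_neq ab; rewrite /c; lra.
have bc : b != c by apply: contra_neq ab; rewrite /c; lra.
have := ltrD (tangent _ a0 ac) (tangent _ b0 bc).
have -> : c `^ p * (1 + p * (a / c - 1)) + c `^ p * (1 + p * (b / c - 1)) = 2 * c `^ p.
  have -> : b = 2 * c - a by rewrite /c; lra.
  by field; rewrite gt_eqF.
by [].
Qed.

Lemma powR_midpoint (R : realType) (p a b : R) : 1 < p -> 0 <= a -> 0 <= b ->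
  2 * ((a + b) / 2) `^ p <= a `^ p + b `^ p.
Proof.
move=> p1 a0 b0; have [->|ab] := eqVneq a b.
  have -> : (b + b) / 2 = b by lra.
  by lra.
exact/ltW/powR_midpoint_strict.
Qed.

(** With c = a + b both a/c and b/c lie in ]0, 1[, where z^p < z; these two
    fractions add up to 1. *)
Lemma powR_superadd_strict (R : realType) (p a b : R) : 1 < p -> 0 < a -> 0 < b ->
  a `^ p + b `^ p < (a + b) `^ p.
Proof.
move=> p1 a0 b0; set c := a + b; have c0 : 0 < c by rewrite addr_gt0.
have shrink x : 0 < x -> x < c -> x `^ p < c `^ p * (x / c).
  move=> x0 xc.
  have -> : x `^ p = c `^ p * (x / c) `^ p.
    by apply: powR_rescale => //; exact: ltW.
  have xc0 : 0 < x / c by rewrite divr_gt0.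
  have -> : p = 1 + (p - 1) by ring.
  rewrite ltr_pM2l ?powR_gt0// powRD ?powRr1 ?ltW//; last by rewrite (gt_eqF xc0) implybT.
  rewrite gtr_pMr//.
  have pm : 0 < p - 1 by rewrite subr_gt0.
  have := @gt0_ltr_powR _ _ pm (x / c) 1.
  by rewrite !nnegrE powR1 ler01 (ltW xc0) ltr_pdivrMr// mul1r; apply.
have ac : a < c by rewrite /c ltrDl.
have bc : b < c by rewrite /c ltrDr.
apply: lt_le_trans (ltrD (shrink _ a0 ac) (shrink _ b0 bc)) _.
by rewrite -mulrDr -mulrDl divff ?mulr1 ?gt_eqF.
Qed.

(** Reduces the exponent p to p/2 on squares, where the parallelogram identity
    of the real line applies. *)
Lemma normr_powR_sqr (R : realType) (p a : R) : `|a| `^ p = (a ^+ 2) `^ (p / 2).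
Proof.
by rewrite -real_normK ?num_real// -powR_mulrn// -powRrM; congr (_ `^ _); field.
Qed.

(** Convexity of t^(p/2) at the squares of a + b and a - b, whose mean is
    a^2 + b^2, followed by strict superadditivity. *)
Lemma clarkson_gt2 (R : realType) (p a b : R) : 2 < p -> a * b != 0 ->
  2 * (`|a| `^ p + `|b| `^ p) < `|a + b| `^ p + `|a - b| `^ p.
Proof.
move=> p2; rewrite mulf_eq0 negb_or => /andP[a0 b0].
rewrite !normr_powR_sqr.
have q1 : 1 < p / 2 by lra.
have hs := @powR_superadd_strict _ _ (a ^+ 2) (b ^+ 2) q1.
have hm := @powR_midpoint _ _ ((a + b) ^+ 2) ((a - b) ^+ 2) q1 (sqr_ge0 _) (sqr_ge0 _).
apply: lt_le_trans hm; rewrite ltr_pM2l//.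
have -> : ((a + b) ^+ 2 + (a - b) ^+ 2) / 2 = a ^+ 2 + b ^+ 2 by field.
by apply: hs; rewrite exprn_even_gt0.
Qed.

(** The reverse of the case p > 2: now t^(p/2) is the inverse of the convex
    power 2/p, so the two power inequalities are applied to that exponent. *)
Lemma clarkson_lt2 (R : realType) (p a b : R) : 0 < p -> p < 2 -> a * b != 0 ->
  `|a + b| `^ p + `|a - b| `^ p < 2 * (`|a| `^ p + `|b| `^ p).
Proof.
move=> p0 p2; rewrite mulf_eq0 negb_or => /andP[a0 b0].
rewrite !normr_powR_sqr.
set q := p / 2; have q0 : 0 < q by rewrite divr_gt0.
have q1 : 1 < q^-1 by rewrite invf_gt1// /q; lra.
have K x : 0 <= x -> (x `^ q) `^ q^-1 = x.
  by move=> x0; rewrite -powRrM mulfV ?powRr1// gt_eqF.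
have hs : a ^+ 2 + b ^+ 2 < ((a ^+ 2) `^ q + (b ^+ 2) `^ q) `^ q^-1.
  rewrite -[in ltLHS](K (a ^+ 2)) ?sqr_ge0// -[in ltLHS](K (b ^+ 2)) ?sqr_ge0//.
  by apply: powR_superadd_strict => //; rewrite powR_gt0// exprn_even_gt0.
set u := (a + b) ^+ 2; set v := (a - b) ^+ 2.
have hm : 2 * ((u `^ q + v `^ q) / 2) `^ q^-1 <= u + v.
  rewrite -[in leRHS](K u) ?sqr_ge0// -[in leRHS](K v) ?sqr_ge0//.
  by apply: powR_midpoint; rewrite ?powR_ge0.
have e : u + v = 2 * (a ^+ 2 + b ^+ 2) by rewrite /u /v; ring.
have : ((u `^ q + v `^ q) / 2) `^ q^-1 < ((a ^+ 2) `^ q + (b ^+ 2) `^ q) `^ q^-1.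
  by apply: le_lt_trans hs; lra.
rewrite ltNge => H; rewrite ltNge; apply: contra H => H.
apply: ge0_ler_powR; rewrite ?nnegrE ?invr_ge0 ?(ltW q0)//.
- by rewrite addr_ge0 ?powR_ge0.
- by rewrite divr_ge0 ?addr_ge0 ?powR_ge0.
- lra.
Qed.

(** * Power sums and the geometry of l^p *)

(** The p-th power of the l^p norm; being a sum over the coordinates, it lets
    equality cases be read off coordinate by coordinate. *)
Definition lp_mass (R : realType) d (p : R) (x : 'rV[R]_d) : R :=
  \sum_(i < d) `|x ord0 i| `^ p.

Section LpMass.
Variables (R : realType) (d : nat) (p : R).
Implicit Types x y : 'rV[R]_d.

Lemma lp_mass_ge0 x : 0 <= lp_mass p x.
Proof. by apply: sumr_ge0 => i _; rewrite powR_ge0. Qed.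

Lemma lp_norm_powR x : 1 < p -> lp_norm p x `^ p = lp_mass p x.
Proof.
move=> p1; have p0 : p != 0 by rewrite gt_eqF// (lt_trans ltr01).
by rewrite /lp_norm -powRrM mulVf// powRr1 ?lp_mass_ge0.
Qed.

Lemma lp_mass_scale a x : lp_mass p (a *: x) = `|a| `^ p * lp_mass p x.
Proof.
rewrite /lp_mass mulr_sumr; apply: eq_bigr => i _.
by rewrite mxE normrM powRM.
Qed.

Lemma lp_norm_scale a x : p != 0 -> 0 <= a -> lp_norm p (a *: x) = a * lp_norm p x.
Proof.
move=> p0 a0; rewrite /lp_norm -/(lp_mass p x) -/(lp_mass p (a *: x)) lp_mass_scale.
by rewrite powRM ?powR_ge0 ?lp_mass_ge0// -powRrM mulfV// powRr1// ger0_norm.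
Qed.

Lemma lp_mass0 : p != 0 -> lp_mass p (0 : 'rV[R]_d) = 0.
Proof. by move=> p0; apply: big1 => i _; rewrite mxE normr0 powR0. Qed.

Lemma lp_mass_delta (i : 'I_d) : p != 0 -> lp_mass p (delta_mx ord0 i) = 1.
Proof.
move=> p0; rewrite /lp_mass (bigD1 i)//= mxE !eqxx normr1 powR1 big1 ?addr0// => j ji.
by rewrite mxE (negbTE ji) andbF normr0 powR0.
Qed.

Lemma lp_mass_delta2 (i j : 'I_d) (a b : R) : p != 0 -> i != j ->
  lp_mass p (a *: delta_mx ord0 i + b *: delta_mx ord0 j) = `|a| `^ p + `|b| `^ p.
Proof.
move=> p0 ij; rewrite /lp_mass (bigD1 i)//= (bigD1 j)/=; last by rewrite eq_sym.
rewrite !mxE !eqxx (negbTE ij) [j == i]eq_sym (negbTE ij) !mulr1 !mulr0 addr0 add0r.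
rewrite big1 ?addr0// => k /andP[ki kj].
by rewrite !mxE (negbTE ki) (negbTE kj) !mulr0 addr0 normr0 powR0.
Qed.

Lemma norm_powR_midpoint (a b : R) : 1 < p ->
  2 * `|(a + b) / 2| `^ p <= `|a| `^ p + `|b| `^ p ?= iff (a == b).
Proof.
move=> p1; have h : `|(a + b) / 2| <= (`|a| + `|b|) / 2.
  by rewrite normrM (ger0_norm (_ : 0 <= 2^-1)) ?invr_ge0// ler_pM2r ?ler_normD ?invr_gt0.
have p0 : 0 < p by lra.
have mono (x y : R) : 0 <= x -> x < y -> x `^ p < y `^ p.
  by move=> x0 xy; apply: gt0_ltr_powR; rewrite ?nnegrE// (le_trans x0)// ltW.
have [<-|ab] /= := eqVneq a b.
  have -> : (a + a) / 2 = a by lra.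
  have -> : 2 * `|a| `^ p = `|a| `^ p + `|a| `^ p by ring.
  by rewrite /Order.leif lexx eqxx.
apply/leifP; have [nab|nab] := eqVneq `|a| `|b|.
  have aNb : a = - b.
    by move/eqP: nab; rewrite eqr_norm2 (negbTE ab) /= => /eqP.
  have a0 : a != 0 by apply: contra_neq ab; lra.
  rewrite -nab; have -> : (a + b) / 2 = 0 by lra.
  rewrite normr0 powR0 ?gt_eqF// mulr0 addr_gt0// powR_gt0// normr_gt0//.
apply: le_lt_trans (powR_midpoint_strict p1 (normr_ge0 _) (normr_ge0 _) nab).
by rewrite ler_pM2l// ge0_ler_powR ?nnegrE ?(ltW p0)// divr_ge0// addr_ge0.
Qed.

(** Equality in the triangle inequality for vectors of equal norm: it is an
    equality in a sum of strict midpoint inequalities, hence holds in each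
    coordinate. *)
Lemma lp_mass_strict_convex x y : 1 < p ->
  lp_mass p x = lp_mass p y -> lp_mass p (x + y) = 2 `^ p * lp_mass p x -> x = y.
Proof.
move=> p1 xy xDy.
have le : \sum_(i < d) 2 * `|(x ord0 i + y ord0 i) / 2| `^ p <=
    \sum_(i < d) (`|x ord0 i| `^ p + `|y ord0 i| `^ p) ?= iff
    [forall i : 'I_d, true ==> (x ord0 i == y ord0 i)].
  by apply: leif_sum => i _; apply: norm_powR_midpoint.
apply/rowP => i.
have {}le := le.2.
suff E : \sum_(i < d) 2 * `|(x ord0 i + y ord0 i) / 2| `^ p ==
    \sum_(i < d) (`|x ord0 i| `^ p + `|y ord0 i| `^ p).
  by move: E; rewrite le => /forallP/(_ i)/eqP.
apply/eqP; transitivity (2 * lp_mass p x); last first.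
  by rewrite big_split /= mulr_natl mulr2n {2}xy.
rewrite -mulr_sumr; congr (2 * _).
have E : x + y = 2 *: ((2^-1 : R) *: (x + y)).
  by rewrite scalerA mulfV ?scale1r// gt_eqF.
move: xDy; rewrite {}E lp_mass_scale ger0_norm//.
have /mulfI inj : (2 : R) `^ p != 0 by rewrite gt_eqF// powR_gt0.
by move=> /inj <-; apply: eq_bigr => k _; rewrite !mxE mulrC.
Qed.

(** For p different from 2 the defect in the parallelogram identity has a fixed
    sign in every coordinate and vanishes only where one entry does; a zero sum
    of defects therefore makes them all vanish. *)
Lemma lp_mass_disjoint x y : 1 < p -> p != 2 ->
  lp_mass p (x + y) + lp_mass p (x - y) = 2 * (lp_mass p x + lp_mass p y) ->
  forall i, x ord0 i * y ord0 i = 0.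
Proof.
move=> p1 p2 E i.
pose defect i := `|x ord0 i + y ord0 i| `^ p + `|x ord0 i - y ord0 i| `^ p
  - 2 * (`|x ord0 i| `^ p + `|y ord0 i| `^ p).
have S0 : \sum_(i < d) defect i = 0.
  rewrite /defect sumrB big_split /= -mulr_sumr big_split /= -!/(lp_mass _ _).
  apply/eqP; rewrite subr_eq0 -E /lp_mass; apply/eqP; congr (_ + _);
    by apply: eq_bigr => k _; rewrite !mxE.
have par (a b : R) : a * b = 0 ->
    `|a + b| `^ p + `|a - b| `^ p = 2 * (`|a| `^ p + `|b| `^ p).
  have z : (0 : R) `^ p = 0 by rewrite powR0// gt_eqF; lra.
  move=> /eqP; rewrite mulf_eq0 => /orP[] /eqP->.
    by rewrite add0r sub0r normrN normr0 z add0r; ring.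
  by rewrite addr0 subr0 normr0 z; ring.
have [lt2|gt2] : p < 2 \/ 2 < p by move/eqP: p2; lra.
- apply/eqP; apply: contraT => xy.
  have le0 k : 0 <= - defect k.
    rewrite oppr_ge0 subr_le0; have [/par->//|] := eqVneq (x ord0 k * y ord0 k) 0.
    by move=> h; apply/ltW/clarkson_lt2 => //; lra.
  have S0' : \sum_(i < d) - defect i = 0 by rewrite sumrN S0 oppr0.
  have /eqP := psumr_eq0P (fun k _ => le0 k) S0' (i := i) isT.
  rewrite oppr_eq0 subr_eq0 lt_eqF//; apply: clarkson_lt2 => //; lra.
- apply/eqP; apply: contraT => xy.
  have ge0 k : 0 <= defect k.
    rewrite subr_ge0; have [/par->//|] := eqVneq (x ord0 k * y ord0 k) 0.
    by move=> h; apply/ltW/clarkson_gt2.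
  have /eqP := psumr_eq0P (fun k _ => ge0 k) S0 (i := i) isT.
  by rewrite subr_eq0 gt_eqF//; apply: clarkson_gt2.
Qed.

End LpMass.

(** * Rigidity of isometric copies in l^p *)

(** Picking one coordinate in each support gives an injection of the d indices
    into themselves; it is onto, so no support has room for a second coordinate. *)
Lemma disjoint_supports_axis (R : realType) d (f : 'I_d -> 'rV[R]_d) :
  (forall i, f i != 0) ->
  (forall i j, i != j -> forall t, f i ord0 t * f j ord0 t = 0) ->
  forall i, exists t, f i = f i ord0 t *: delta_mx ord0 t.
Proof.
move=> f0 disj i.
have /choice[s sP] : forall j, exists t, f j ord0 t != 0.
  by move=> j; have /rV0Pn := f0 j.
have s_inj : injective s.
  move=> j k jk; apply/eqP; apply: contraT => /disj/(_ (s j))/eqP.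
  by rewrite mulf_eq0 {2}jk (negbTE (sP j)) (negbTE (sP k)).
exists (s i); apply/rowP => u; rewrite !mxE eqxx /=.
have [->|us] := eqVneq u (s i); first by rewrite mulr1.
have /codomP[j uj] := injF_onto s_inj u.
have ij : i != j by apply: contra_neq us => ->.
have /eqP := disj _ _ ij u; rewrite mulr0 mulf_eq0 => /orP[/eqP//|].
by rewrite uj (negbTE (sP j)).
Qed.

Section Rigidity.
Variables (R : realType) (d : nat) (p r : R) (P : set 'rV[R]_d).
Variable phi : 'rV[R]_d -> 'rV[R]_d.
Hypotheses (p1 : 1 < p) (p2 : p != 2) (r0 : 0 < r).
Hypothesis phi_iso : forall u v, P u -> P v ->
  lp_norm p (phi u - phi v) = r * lp_norm p (u - v).

Let pn0 : p != 0. Proof. by rewrite gt_eqF// (lt_trans ltr01). Qed.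

Lemma lp_copy_mass u v : P u -> P v ->
  lp_mass p (phi u - phi v) = r `^ p * lp_mass p (u - v).
Proof.
move=> Pu Pv; rewrite -!lp_norm_powR// phi_iso// powRM ?powR_ge0//.
exact: ltW.
Qed.

(** The image of u + w is at distance r |w| from both other images, which are
    2 r |w| apart: equality in the triangle inequality makes it their midpoint. *)
Lemma lp_copy_affine u w : P u -> P (u + w) -> P (u + 2 *: w) ->
  phi (u + 2 *: w) - phi (u + w) = phi (u + w) - phi u.
Proof.
move=> Pu Pv Pw; symmetry.
have e1 : u + w - u = w by rewrite [LHS]addrC addKr.
have e2 : u + 2 *: w - (u + w) = w by rewrite scaler_nat mulr2n addrA [LHS]addrC addKr.
have e3 : u + 2 *: w - u = 2 *: w by rewrite [LHS]addrC addKr.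
apply: (lp_mass_strict_convex p1).
  by rewrite !lp_copy_mass// e1 e2.
rewrite addrC addrA subrK !lp_copy_mass// e1 e3 lp_mass_scale ger0_norm//.
by rewrite mulrCA.
Qed.

(** The points - e_i turn the distances between phi (e_i) and phi (e_j), and
    between phi (e_i) and phi (- e_j), into a parallelogram identity for
    phi (e_i) - phi 0 and phi (e_j) - phi 0. Starting the progression at - e_i0
    lets it contain e_i0, 0 and - e_i0, so that these points are not counted twice. *)
Lemma lp_copy_axis (i0 : 'I_d) (m : nat) :
  P 0 -> (forall i, P (delta_mx ord0 i)) -> (forall i, P (- delta_mx ord0 i)) ->
  (forall k, (k < m)%N -> P ((k%:R - 1) *: delta_mx ord0 i0)) ->
  exists (t : 'I_d) (c : R), `|c| = r /\ forall k, (k < m)%N ->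
    phi ((k%:R - 1) *: delta_mx ord0 i0) =
    phi 0 + ((k%:R - 1) * c) *: delta_mx ord0 t.
Proof.
move=> P0 Pe Pn Pap.
pose f i := phi (delta_mx ord0 i) - phi 0.
have fM i : lp_mass p (f i) = r `^ p.
  by rewrite lp_copy_mass// subr0 lp_mass_delta// mulr1.
have fN i : phi (- delta_mx ord0 i) = phi 0 - f i.
  have := @lp_copy_affine (- delta_mx ord0 i) (delta_mx ord0 i).
  have -> : - delta_mx ord0 i + delta_mx ord0 i = 0 :> 'rV[R]_d by rewrite addNr.
  have -> : - delta_mx ord0 i + 2 *: delta_mx ord0 i = delta_mx ord0 i :> 'rV[R]_d.
    by rewrite scaler_nat mulr2n addKr.
  by move=> h; rewrite /f h// opprB addrC subrK.
have f0 i : f i != 0.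
  apply/eqP => fi0; have := fM i; rewrite fi0 lp_mass0// => /esym/eqP.
  by rewrite gt_eqF// powR_gt0.
have disj i j : i != j -> forall t, f i ord0 t * f j ord0 t = 0.
  move=> ij; apply: (lp_mass_disjoint p1 p2).
  have -> : f i + f j = phi (delta_mx ord0 i) - phi (- delta_mx ord0 j).
    by rewrite fN /f; apply/rowP => u; rewrite !mxE; ring.
  have -> : f i - f j = phi (delta_mx ord0 i) - phi (delta_mx ord0 j).
    by rewrite /f; apply/rowP => u; rewrite !mxE; ring.
  rewrite !fM !lp_copy_mass// opprK.
  have := lp_mass_delta2 1 1 pn0 ij; have := lp_mass_delta2 1 (-1) pn0 ij.
  rewrite !scale1r scaleN1r normrN normr1 powR1 => -> ->; ring.
have [t ft] := disjoint_supports_axis f0 disj i0.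
exists t, (f i0 ord0 t); set c := f i0 ord0 t in ft *; split.
  have := fM i0; rewrite ft lp_mass_scale lp_mass_delta// mulr1.
  by apply: (powR_injective (lt_trans ltr01 p1)); rewrite nnegrE ?normr_ge0 ?(ltW r0).
have {}ft : phi (delta_mx ord0 i0) = phi 0 + c *: delta_mx ord0 t.
  by rewrite -ft /f addrC subrK.
(* Two consecutive terms are carried along, since each term is determined by
   the two preceding ones. *)
suff H k : ((k < m)%N -> phi ((k%:R - 1) *: delta_mx ord0 i0) =
    phi 0 + ((k%:R - 1) * c) *: delta_mx ord0 t) /\
    ((k.+1 < m)%N -> phi ((k.+1%:R - 1) *: delta_mx ord0 i0) =
    phi 0 + ((k.+1%:R - 1) * c) *: delta_mx ord0 t).
  by move=> k; case: (H k).
elim: k => [|k [IH1 IH2]]; first split => _.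
- have -> : 0%:R - 1 = -1 :> R by ring.
  by rewrite scaleN1r fN /f ft mulN1r scaleNr addrAC subrr add0r.
- by rewrite subrr mul0r !scale0r addr0.
split=> // km.
have := @lp_copy_affine ((k%:R - 1) *: delta_mx ord0 i0) (delta_mx ord0 i0).
have -> : (k%:R - 1) *: delta_mx ord0 i0 + delta_mx ord0 i0 =
    (k.+1%:R - 1) *: delta_mx ord0 i0 :> 'rV[R]_d.
  by rewrite -[X in _ + X]scale1r -scalerDl; congr (_ *: _); rewrite -natr1; ring.
have -> : (k%:R - 1) *: delta_mx ord0 i0 + 2 *: delta_mx ord0 i0 =
    (k.+2%:R - 1) *: delta_mx ord0 i0 :> 'rV[R]_d.
  by rewrite -scalerDl; congr (_ *: _); rewrite -!natr1; ring.
have km1 : (k.+1 < m)%N by apply: ltn_trans km.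
have km0 : (k < m)%N by apply: ltn_trans km1.
move=> /(_ (Pap _ km0) (Pap _ km1) (Pap _ km)).
rewrite IH1// IH2// => /(canRL (subrK _)) ->.
apply/rowP => u; rewrite !mxE -!natr1; ring.
Qed.

End Rigidity.

(** * The outer measure of covers by boxes *)

Section OuterMeasure.
Variables (R : realType) (d : nat).
Implicit Types (a b v : 'rV[R]_d) (E X : set 'rV[R]_d).

Lemma box_volume_ge0 a b : (forall i, a ord0 i <= b ord0 i) -> 0 <= box_volume a b.
Proof. by move=> ab; apply: prodr_ge0 => i _; rewrite subr_ge0. Qed.

Lemma le_lebesgue_Rd X E : X `<=` E -> (lebesgue_Rd X <= lebesgue_Rd E)%E.
Proof.
move=> XE; apply: le_ereal_inf => _ [a [b [[ab cE] ->]]].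
by exists a, b; split=> //; split=> //; exact: subset_trans cE.
Qed.

Lemma lebesgue_Rd_ge0 E : (0 <= lebesgue_Rd E)%E.
Proof.
apply: le_ereal_inf_tmp => _ [a [b [[ab _] ->]]].
by apply: nneseries_ge0 => k _ _; rewrite lee_fin box_volume_ge0.
Qed.

Lemma lebesgue_Rd_le_cover E (c e : nat -> 'rV[R]_d) :
  box_cover E c e -> (lebesgue_Rd E <= \sum_(0 <= k <oo) (box_volume (c k) (e k))%:E)%E.
Proof. by move=> ce; apply: ereal_inf_lbound; exists c, e. Qed.

(** A cover indexed by pairs is renumbered by the naturals; this is what merging
    countably many countable covers requires. *)
Lemma lebesgue_Rd_le_pair_cover E (a b : nat * nat -> 'rV[R]_d) :
  (forall k i, a k ord0 i <= b k ord0 i) ->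
  E `<=` \bigcup_k box (a k) (b k) ->
  (lebesgue_Rd E <= \esum_(k in setT) (box_volume (a k) (b k))%:E)%E.
Proof.
move=> ab cE; have /card_esym/ppcard_eqP[f] := card_nat2.
rewrite (reindex_esum setT setT f)// -nneseries_esumT; last by move=> k; rewrite lee_fin box_volume_ge0.
apply: ereal_inf_lbound; exists (a \o f), (b \o f); split=> //; split=> [k i|x /cE[k _ kx]].
  exact: ab.
by exists (f^-1%FUN k) => //=; rewrite invK ?inE.
Qed.

Lemma lebesgue_Rd_sigma_subadditive : sigma_subadditive (@lebesgue_Rd R d).
Proof.
move=> A; have [[i ioo]|] := pselect (exists i, lebesgue_Rd (A i) = +oo%E).
  rewrite (eseries_pinfty _ _ ioo) ?leey// => n _.
  by rewrite -ltNye (lt_le_trans _ (lebesgue_Rd_ge0 _)).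
rewrite -forallNE => Aoo; apply/lee_addgt0Pr => e e0.
rewrite (le_trans _ (epsilon_trick _ (fun n => lebesgue_Rd_ge0 (A n)) (ltW e0)))//.
have /choice[G PG] n : exists ab : (nat -> 'rV[R]_d) * (nat -> 'rV[R]_d),
    box_cover (A n) ab.1 ab.2 /\
    (\sum_(0 <= k <oo) (box_volume (ab.1 k) (ab.2 k))%:E <=
      lebesgue_Rd (A n) + (e / (2 ^ n.+1)%:R)%:E)%E.
  have en : 0 < e / (2 ^ n.+1)%:R by rewrite divr_gt0// ltr0n expn_gt0.
  have fin : lebesgue_Rd (A n) \is a fin_num.
    by rewrite ge0_fin_numE ?lebesgue_Rd_ge0// ltey; exact/eqP.
  have [_ [a [b [ab ->]]] lt] := lb_ereal_inf_adherent en fin.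
  by exists (a, b); split=> //; exact: ltW.
have ge0 n k : (0 <= (box_volume ((G n).1 k) ((G n).2 k))%:E)%E.
  by rewrite lee_fin box_volume_ge0// => i; exact: (PG n).1.1.
apply: (@le_trans _ _ (\esum_(k in [set: nat * nat])
    (box_volume ((G k.1).1 k.2) ((G k.1).2 k.2))%:E)).
  apply: (@lebesgue_Rd_le_pair_cover _ (fun k => (G k.1).1 k.2) (fun k => (G k.1).2 k.2)).
    by move=> k i; exact: (PG k.1).1.1.
  move=> x [n _ /(PG n).1.2[k _ kx]]; by exists (n, k).
rewrite (_ : setT = [set: nat] `*`` (fun=> [set: nat])); last first.
  by apply/seteqP; split.
rewrite -(@esum_esum _ _ _ setT (fun=> setT)
  (fun n k => (box_volume ((G n).1 k) ((G n).2 k))%:E))//.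
rewrite nneseries_esumT; last first.
  move=> n; rewrite adde_ge0 ?lebesgue_Rd_ge0// lee_fin divr_ge0// ltW//.
apply: le_esum => n _; rewrite -nneseries_esumT//; exact: (PG n).2.
Qed.

Lemma lebesgue_Rd_translate E v :
  (lebesgue_Rd E <= lebesgue_Rd [set (x + v)%R | x in E])%E.
Proof.
apply: le_ereal_inf_tmp => _ [a [b [[ab cE] ->]]].
apply: ereal_inf_lbound; exists (fun k => a k - v), (fun k => b k - v); split.
  split=> [k i|x Ex]; first by rewrite !mxE lerD2r.
  have [k _ kx] := cE (x + v) (ex_intro2 _ _ x Ex erefl).
  exists k => // i; have := kx i; rewrite !in_itv/= !mxE.
  by rewrite ltrBlDr lerBrDr.
apply: eq_eseriesr => k _; congr _%:E; apply: eq_bigr => i _; rewrite !mxE; ring.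
Qed.

(** The indicator of the box ]a, b] with the coordinates below [j] integrated
    out: it interpolates between the indicator (j = 0) and the volume (j = d). *)
Definition partial_volume (j : nat) a b (x : 'I_d -> R) : R :=
  \prod_(i < d) (if (i < j)%N then b ord0 i - a ord0 i
                 else (\1_(`]a ord0 i, b ord0 i]) (x i))).

Definition update (x : 'I_d -> R) (j : 'I_d) (t : R) : 'I_d -> R :=
  fun i => if i == j then t else x i.

Lemma partial_volume_ge0 j a b x : (forall i, a ord0 i <= b ord0 i) ->
  0 <= partial_volume j a b x.
Proof. by move=> ab; apply: prodr_ge0 => i _; case: ifP; rewrite ?subr_ge0. Qed.

(** The common factor [c] is the product over the other coordinates: as a
    function of the j-th variable alone, [partial_volume j] is [c] times the
    indicator of an interval. *)
Lemma partial_volume_step (j : 'I_d) a b x : exists c, [/\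
  ((forall i, a ord0 i <= b ord0 i) -> 0 <= c),
  partial_volume j.+1 a b x = c * (b ord0 j - a ord0 j) &
  forall t, partial_volume j a b (update x j t) = c * \1_(`]a ord0 j, b ord0 j]) t].
Proof.
exists (\prod_(i < d | i != j) (if (i < j)%N then b ord0 i - a ord0 i
                 else (\1_(`]a ord0 i, b ord0 i]) (x i)))); split.
- by move=> ab; apply: prodr_ge0 => i _; case: ifP; rewrite ?subr_ge0.
- rewrite /partial_volume (bigD1 j)//= ltnS leqnn mulrC; congr (_ * _).
  by apply: eq_bigr => i ij; rewrite ltnS leq_eqVlt -[_ == _ :> nat]/(i == j) (negbTE ij).
- move=> t; rewrite /partial_volume (bigD1 j)//= ltnn mulrC /update eqxx; congr (_ * _).
  by apply: eq_bigr => i ij; rewrite (negbTE ij).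
Qed.

Lemma integral_partial_volume (j : 'I_d) a b x : (forall i, a ord0 i <= b ord0 i) ->
  (\int[lebesgue_measure]_t (partial_volume j a b (update x j t))%:E =
   (partial_volume j.+1 a b x)%:E)%E.
Proof.
move=> ab; have [c [c0 -> E]] := partial_volume_step j a b x.
under eq_integral do rewrite E EFinM.
rewrite ge0_integralZl_EFin ?c0//; last first.
  by apply/measurable_EFinP; exact: measurable_indic.
rewrite integral_indic// setIT EFinM; congr (_ * _)%E.
rewrite [LHS]lebesgue_measure_itv /= lte_fin.
by have := ab j; rewrite le_eqVlt => /predU1P[->|->]; rewrite ?ltxx ?subrr// EFinB.
Qed.

Lemma measurable_partial_volume (j : 'I_d) a b x :
  measurable_fun setT (fun t => (partial_volume j a b (update x j t))%:E).
Proof.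
have [c [_ _ E]] := partial_volume_step j a b x.
under eq_fun do rewrite E.
apply/measurable_EFinP; apply: measurable_funM => //; exact: measurable_indic.
Qed.

(** The indicator of the box is at most the sum of the indicators of the covering
    boxes. Integrating this inequality successively in each coordinate, with
    monotone convergence for the series, turns indicators into volumes. *)
Lemma box_volume_le_cover a b (A B : nat -> 'rV[R]_d) :
  (forall i, a ord0 i <= b ord0 i) -> box_cover (box a b) A B ->
  ((box_volume a b)%:E <= \sum_(0 <= k <oo) (box_volume (A k) (B k))%:E)%E.
Proof.
move=> ab [AB cov].
have ge0 j k x : (0 <= (partial_volume j (A k) (B k) x)%:E)%E.
  by rewrite lee_fin partial_volume_ge0.
suff H j x : (j <= d)%N -> ((partial_volume j a b x)%:E <=
    \sum_(0 <= k <oo) (partial_volume j (A k) (B k) x)%:E)%E.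
  have volE c e : box_volume c e = partial_volume d c e (fun=> 0).
    by apply: eq_bigr => i _; rewrite ltn_ord.
  rewrite volE; apply: le_trans (H d _ (leqnn _)) _.
  by apply: lee_nneseries => // k _; rewrite volE.
elim: j x => [x _|j IH x jd].
  have [xab|nxab] := pselect (forall i, x i \in `]a ord0 i, b ord0 i]); last first.
    rewrite (_ : partial_volume 0 a b x = 0); first exact: nneseries_ge0.
    move/existsNP: nxab => [i /negP xi].
    by rewrite /partial_volume (bigD1 i)//= indicE mem_setE (negbTE xi) mul0r.
  have [k _ kx] : (\bigcup_k box (A k) (B k)) (\row_i x i).
    by apply: cov => i; rewrite mxE.
  have one (c e : 'rV[R]_d) : (forall i, x i \in `]c ord0 i, e ord0 i]) -> partial_volume 0 c e x = 1.
    by move=> xce; apply: big1 => i _ /=; rewrite indicE mem_setE xce.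
  rewrite one// (nneseries_split _ k.+1)// add0n big_nat_recr//= one; last first.
    by move=> i; have := kx i; rewrite mxE.
  rewrite -addeA addeCA leeDl// adde_ge0 ?sume_ge0 ?nneseries_ge0//.
pose j' := Ordinal jd.
rewrite -(integral_partial_volume j')//.
under eq_eseriesr do rewrite -(integral_partial_volume j')//.
rewrite -integral_nneseries//=; last by move=> k; exact: (measurable_partial_volume j').
apply: ge0_le_integral => //.
- by move=> t _; rewrite lee_fin partial_volume_ge0.
- exact: (measurable_partial_volume j').
- by apply: ge0_emeasurable_sum => // k _; exact: (measurable_partial_volume j').
- by move=> t _; exact: IH (ltnW jd).
Qed.

Lemma box_volume_le a b : (forall i, a ord0 i <= b ord0 i) ->
  ((box_volume a b)%:E <= lebesgue_Rd (box a b))%E.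
Proof.
by move=> ab; apply: le_ereal_inf_tmp => _ [A [B [cov ->]]]; exact: box_volume_le_cover.
Qed.

End OuterMeasure.

(** * Measurable sets *)

Section Measurable.
Variables (R : realType) (d : nat).
Implicit Types (a b v x : 'rV[R]_d.+1) (E X : set 'rV[R]_d.+1).

(** Positive dimension is needed here: the constant sequence of boxes ]0, 0] pads
    the cover at no cost, whereas in dimension 0 every box has volume 1. *)
Lemma lebesgue_Rd_box_le a b : (forall i, a ord0 i <= b ord0 i) ->
  (lebesgue_Rd (box a b) <= (box_volume a b)%:E)%E.
Proof.
move=> ab.
have cov : box_cover (box a b) (fun k => if k is 0%N then a else 0)
    (fun k => if k is 0%N then b else 0).
  by split=> [[|k] i|x abx]; rewrite ?mxE//; exists 0%N.
apply: le_trans (lebesgue_Rd_le_cover cov) _.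
rewrite nneseries_recl//; last first.
  by move=> k _; rewrite lee_fin box_volume_ge0// => i; case: k; rewrite ?mxE.
rewrite eseries0 ?adde0// => -[|k]//= _ _.
by rewrite /box_volume big_ord_recl !mxE subrr mul0r.
Qed.

Lemma lebesgue_Rd_box a b : (forall i, a ord0 i <= b ord0 i) ->
  lebesgue_Rd (box a b) = (box_volume a b)%:E.
Proof.
by move=> ab; apply/eqP; rewrite eq_le lebesgue_Rd_box_le// box_volume_le.
Qed.

Lemma lebesgue_Rd0 : lebesgue_Rd (set0 : set 'rV[R]_d.+1) = 0%E.
Proof.
apply/eqP; rewrite eq_le lebesgue_Rd_ge0 andbT.
have := @lebesgue_Rd_box_le 0 0 (fun i => lexx _).
rewrite /box_volume big_ord_recl !mxE subrr mul0r; apply: le_trans.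
exact: le_lebesgue_Rd.
Qed.

HB.instance Definition _ := isOuterMeasure.Build R 'rV[R]_d.+1 (@lebesgue_Rd R d.+1)
  lebesgue_Rd0 (@lebesgue_Rd_ge0 R d.+1) (@le_lebesgue_Rd R d.+1)
  (@lebesgue_Rd_sigma_subadditive R d.+1).

(** The hyperplane cuts each box of a cover into two boxes whose volumes add up,
    and the two families cover the two parts of the set. *)
Lemma lebesgue_measurable_halfspace (i : 'I_d.+1) (c : R) :
  lebesgue_measurable [set x : 'rV[R]_d.+1 | x ord0 i <= c].
Proof.
apply: le_caratheodory_measurable => X /=.
apply: le_ereal_inf_tmp => _ [a [b [[ab cE] ->]]].
(* The cut [c] clamped to the i-th side of the box, so that both parts remain
   ordered even when one of them is empty. *)
pose m k := Num.max (a k ord0 i) (Num.min (b k ord0 i) c).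
have am k : a k ord0 i <= m k by rewrite /m le_max lexx.
have mb k : m k <= b k ord0 i by rewrite /m ge_max ab ge_min lexx.
pose b' k : 'rV[R]_d.+1 := \row_j (if j == i then m k else b k ord0 j).
pose a' k : 'rV[R]_d.+1 := \row_j (if j == i then m k else a k ord0 j).
have vol k : box_volume (a k) (b k) = box_volume (a k) (b' k) + box_volume (a' k) (b k).
  have split1 (u w : 'rV[R]_d.+1) : box_volume u w = (w ord0 i - u ord0 i) *
      \prod_(j | j != i) (w ord0 j - u ord0 j) by rewrite /box_volume (bigD1 i).
  rewrite !split1 !mxE eqxx.
  have -> : \prod_(j | j != i) (b' k ord0 j - a k ord0 j) =
      \prod_(j | j != i) (b k ord0 j - a k ord0 j).
    by apply: eq_bigr => j /negbTE ji; rewrite mxE ji.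
  have -> : \prod_(j | j != i) (b k ord0 j - a' k ord0 j) =
      \prod_(j | j != i) (b k ord0 j - a k ord0 j).
    by apply: eq_bigr => j /negbTE ji; rewrite mxE ji.
  by ring.
have ab' k j : a k ord0 j <= b' k ord0 j by rewrite mxE; case: eqP => [->|].
have a'b k j : a' k ord0 j <= b k ord0 j by rewrite mxE; case: eqP => [->|].
under eq_eseriesr do rewrite vol EFinD.
rewrite nneseriesD; last 2 first.
- by move=> k _ _; rewrite lee_fin box_volume_ge0.
- by move=> k _ _; rewrite lee_fin box_volume_ge0.
apply: leeD; apply: lebesgue_Rd_le_cover; split=> // x [Xx /= xc].
  have [k _ kx] := cE _ Xx; exists k => // j; have := kx j; rewrite !in_itv/= mxE.
  case: eqP => [->|//] /andP[-> xb] /=.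
  by rewrite /m le_max le_min xb xc orbT.
have [k _ kx] := cE _ Xx; exists k => // j; have := kx j; rewrite !in_itv/= mxE.
case: eqP => [->|//] /andP[ax ->]; rewrite andbT.
by rewrite /m gt_max ax gt_min; move/negP: xc; rewrite -ltNge => ->; rewrite orbT.
Qed.

(** Rounding up makes the level sets unions of half-open unit boxes ]k - 1, k],
    and an integral step along any axis, in either direction, shifts the value by
    exactly that step. *)
Definition ceil_sum x : int := \sum_i Num.ceil (x ord0 i).

(** A countable union, over the integer vectors with an admissible sum, of finite
    intersections of slabs between coordinate hyperplanes. *)
Lemma lebesgue_measurable_ceil_sum (A : pred int) :
  lebesgue_measurable [set x | A (ceil_sum x)].
Proof.
pose U := caratheodory_type (@lebesgue_Rd R d.+1).
have half i c : measurable ([set x : 'rV[R]_d.+1 | x ord0 i <= c] : set U).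
  exact: lebesgue_measurable_halfspace.
have slab i (z : int) : measurable ([set x : 'rV[R]_d.+1 | Num.ceil (x ord0 i) = z] : set U).
  suff -> : [set x : 'rV[R]_d.+1 | Num.ceil (x ord0 i) = z] =
      [set x | x ord0 i <= z%:~R] `\` [set x | x ord0 i <= (z - 1)%:~R].
    exact: (@measurableD _ U _ _ (half i _) (half i _)).
  apply/seteqP; split=> x /=.
    move=> <-; rewrite ceil_ge; split=> //; apply/negP; rewrite -ltNge.
    exact: ceilB1_lt.
  move=> [xz /negP]; rewrite -ltNge => zx; apply/ceil_def.
  by rewrite zx.
suff : measurable (\bigcup_(f in [set f : {ffun 'I_d.+1 -> int} | A (\sum_i f i)])
    \bigcap_(i in [set: 'I_d.+1]) ([set x : 'rV[R]_d.+1 | Num.ceil (x ord0 i) = f i] : set U)).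
  rewrite [X in measurable X -> _](_ : _ = [set x | A (ceil_sum x)])//.
  apply/seteqP; split=> x /=.
    by move=> [f Af fx]; rewrite /ceil_sum (eq_bigr f)// => i _; exact: fx.
  move=> Ax; exists [ffun i => Num.ceil (x ord0 i)] => /=.
    by rewrite (eq_bigr (fun i => Num.ceil (x ord0 i)))// => i _; rewrite ffunE.
  by move=> i _ /=; rewrite ffunE.
rewrite bigcup_mkcond; apply: countable_bigcupT_measurable => // f.
case: ifP => // _; apply: fin_bigcap_measurable => //.
Qed.

End Measurable.

(** * Translating a finite set into a dense set *)

Lemma cvg_pow_ratio (R : realType) (K : R) (m : nat) :
  (1 + K / s) ^+ m @[s --> +oo] --> (1 : R).
Proof.
suff lim1 : 1 + K / s @[s --> +oo] --> 1 + K * 0.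
  have := cvg_comp _ _ lim1 (@exprn_continuous R m (1 + K * 0)).
  by rewrite mulr0 addr0 expr1n.
apply: cvgD; first exact: cvg_cst.
apply: cvgM; first exact: cvg_cst.
apply/gtr0_cvgV0; last exact: cvg_id.
exact: nbhs_pinfty_gt.
Qed.

Section Density.
Variables (R : realType) (d : nat).
Implicit Types (a b v x : 'rV[R]_d.+1) (E X : set 'rV[R]_d.+1).

(** A box containing the cube of corner [x] and side [s], with a margin [V] that
    absorbs all translations whose coordinates are below [V], so that translated
    cubes are compared through volumes of boxes only. *)
Definition halo x (s V : R) : set 'rV[R]_d.+1 :=
  box (x - const_mx V) (x + const_mx (s + V)).

Lemma lebesgue_Rd_halo x s V : 0 <= s -> 0 <= V ->
  lebesgue_Rd (halo x s V) = ((s + 2 * V) ^+ d.+1)%:E.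
Proof.
move=> s0 V0; rewrite lebesgue_Rd_box; last by move=> i; rewrite !mxE; lra.
congr _%:E; rewrite /box_volume (eq_bigr (fun=> s + 2 * V)); last first.
  by move=> i _; rewrite !mxE; ring.
by rewrite prodr_const card_ord.
Qed.

Lemma lebesgue_Rd_cube_ge x s : 0 <= s ->
  ((s ^+ d.+1)%:E <= lebesgue_Rd (cube x s))%E.
Proof.
move=> s0; have := @lebesgue_Rd_halo x s 0 s0 (lexx _).
rewrite mulr0 addr0 => <-; apply: le_lebesgue_Rd => y hy i.
have := hy i; rewrite !mxE in_itv/=; lra.
Qed.

Lemma cube_translate_halo x s V v : (forall i, `|v ord0 i| < V) ->
  [set (y + v)%R | y in cube x s] `<=` halo x s V.
Proof.
move=> vV _ [y yx <-] i; rewrite in_itv/= !mxE.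
by have := yx i; have := vV i; rewrite ltr_norml; lra.
Qed.

Lemma cube_halo x s V : 0 < V -> cube x s `<=` halo x s V.
Proof.
move=> V0 y yx; apply: (@cube_translate_halo x s V 0).
  by move=> i; rewrite mxE normr0.
by exists y => //; rewrite addr0.
Qed.

Lemma lebesgue_Rd_sub_halo X x s V : 0 <= s -> 0 <= V -> X `<=` halo x s V ->
  lebesgue_Rd X = (fine (lebesgue_Rd X))%:E.
Proof.
move=> s0 V0 XH; rewrite fineK// ge0_fin_numE ?lebesgue_Rd_ge0//.
apply: le_lt_trans (le_lebesgue_Rd XH) _.
by rewrite lebesgue_Rd_halo// ltry.
Qed.

(** Otherwise the translations t in a cube Q rich in E would be covered by the n
    sets of those for which t + q k misses E. Each is a translate of a part of
    the complement of E in the halo of Q, hence has measure at most that of the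
    halo minus that of E in Q, which is less than |Q| / n for a large cube. *)
Lemma dense_translate (n : nat) E (q : nat -> 'rV[R]_d.+1) :
  (0 < n)%N -> lebesgue_measurable E ->
  ((1 - n%:R^-1)%:E < upper_banach_density E)%E ->
  exists t, forall k, (k < n)%N -> E (t + q k).
Proof.
move=> n0 mE; rewrite /upper_banach_density.
set g := fun s : R => ereal_sup _; move=> dens.
have n0' : 0 < n%:R :> R by rewrite ltr0n.
have bound0 : 0 <= 1 - n%:R^-1 :> R by rewrite subr_ge0 invf_le1// ler1n.
(* A divergent limit would be the default value 0, below the assumed bound. *)
have cg : cvg (g @ +oo).
  apply: contrapT => /dvgP gp; move: dens; rewrite gp.
  by rewrite ltNge lee_fin bound0.
have [c [c0 lc]] : exists c : R, 1 - n%:R^-1 < c /\ (c%:E < lim (g @ +oo%R))%E.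
  move: dens; case: (lim _) => [l| |]; last by rewrite ltNge leNye.
    rewrite lte_fin => nl; exists ((1 - n%:R^-1 + l) / 2); rewrite lte_fin; lra.
  by move=> _; exists 2; rewrite ltry; split=> //; have := invr_gt0 (n%:R : R); lra.
(* A crude bound for the coordinates of all the translation vectors. *)
pose V : R := 1 + \sum_(k < n) \sum_i `|q k ord0 i|.
have qV k i : (k < n)%N -> `|q k ord0 i| < V.
  move=> kn; rewrite /V (bigD1 (Ordinal kn))//= (bigD1 i)//=.
  rewrite -[ltLHS]add0r ltr_leD// -addrA lerDl addr_ge0//; last first.
    by apply: sumr_ge0 => j _; apply: sumr_ge0.
  by apply: sumr_ge0.
have V0 : 0 <= V by rewrite addr_ge0// sumr_ge0// => j _; apply: sumr_ge0.
have ev1 : \forall s \near +oo, (c%:E < g s)%E.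
  exact: (cg _ (open_ereal_gt' lc)).
have ev2 : \forall s \near +oo, (1 + 2 * V / s) ^+ d.+1 < c + n%:R^-1.
  apply: cvgr_lt; first exact: cvg_pow_ratio.
  by lra.
have ev3 : \forall s \near +oo, 0 < (s : R) by exact: nbhs_pinfty_gt.
have [s [[gs ms] s0]] := filter_ex (filterI (filterI ev1 ev2) ev3).
have sD : 0 < s ^+ d.+1 by rewrite exprn_gt0.
have [_ [x _ <-] /= cx] := ereal_sup_gt gs.
pose H := halo x s V.
have HE := mE H.
have H1 := @lebesgue_Rd_halo x s V (ltW s0) V0.
have HI := @lebesgue_Rd_sub_halo (H `&` E) x s V (ltW s0) V0 (@subIsetl _ _ _).
have HD := @lebesgue_Rd_sub_halo (H `&` ~` E) x s V (ltW s0) V0 (@subIsetl _ _ _).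
move: HE HI HD; rewrite H1; set z := fine _; set y := fine _.
move=> HE HI HD; rewrite HI HD -EFinD in HE; case: HE => HE.
have cz : c * s ^+ d.+1 < z.
  rewrite -lte_fin EFinM -lte_pdivlMr// -HI.
  apply: lt_le_trans cx _; rewrite lee_pmul2r//; last by rewrite lte_fin invr_gt0.
  apply: le_lebesgue_Rd => t [Et tx]; split=> //.
  by apply: (@cube_halo x s V) => //; rewrite /V ltr_wpDr// sumr_ge0// => j _; apply: sumr_ge0.
have {}ms : (s + 2 * V) ^+ d.+1 < (c + n%:R^-1) * s ^+ d.+1.
  rewrite -ltr_pdivrMr// -expr_div_n; apply: le_lt_trans ms.
  by rewrite mulrDl divff ?gt_eqF.
pose bad k := if (k < n)%N then cube x s `&` [set t | ~ E (t + q k)] else set0.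
have badle k : (lebesgue_Rd (bad k) <= y%:E)%E.
  rewrite /bad; case: ifP => kn; last by rewrite lebesgue_Rd0 -HD lebesgue_Rd_ge0.
  apply: le_trans (lebesgue_Rd_translate _ (q k)) _.
  rewrite -HD; apply: le_lebesgue_Rd => _ [t [tx nEt] <-]; split=> //.
  by apply: (@cube_translate_halo x s V (q k)); [move=> i; exact: qV|exists t].
apply: contrapT => /forallNP noT.
have cov : cube x s `<=` \big[setU/set0]_(k < n) bad k.
  move=> t tx; have /existsNP[k /not_implyP[kn nE]] := noT t.
  by rewrite -bigcup_mkord; exists k => //=; rewrite /bad kn.
have := lebesgue_Rd_cube_ge x (ltW s0).
move/le_trans => /(_ _ (le_lebesgue_Rd cov)).
move/le_trans => /(_ _ (outer_measure_subadditive (@lebesgue_Rd R d.+1) bad n)).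
have bsum : (\sum_(k < n) lebesgue_Rd (bad k) <= \sum_(k < n) y%:E)%E by exact: lee_sum.
move/le_trans => /(_ _ bsum); rewrite sumEFin lee_fin sumr_const card_ord -mulr_natl.
have -> : y = (s + 2 * V) ^+ d.+1 - z by rewrite HE; ring.
apply/negP; rewrite -ltNge mulrC -ltr_pdivlMr//; lra.
Qed.
End Density.

(** * A periodic set of density 1 - 1/m *)

Section Stripes.
Variables (R : realType) (d m : nat).
Hypothesis m0 : (0 < m)%N.
Implicit Types (v x : 'rV[R]_d.+1) (E X : set 'rV[R]_d.+1).

Lemma ceil_sum_shift x (i : 'I_d.+1) (z : int) :
  ceil_sum (x + z%:~R *: delta_mx ord0 i) = ceil_sum x + z.
Proof.
rewrite /ceil_sum (bigD1 i)//= [in RHS](bigD1 i)//= !mxE !eqxx mulr1.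
rewrite ceilDrz ?intr_int// intrKceil addrAC; congr (_ + _ + _).
by apply: eq_bigr => j /negbTE ji; rewrite !mxE ji andbF mulr0 addr0.
Qed.

(** Up to the shift by [j] in the first axis direction, these are the same set;
    for j = 0, ..., m - 1 they partition the space. *)
Definition stripe (j : nat) : set 'rV[R]_d.+1 :=
  [set x | (m %| ceil_sum x + j)%Z].

Lemma lebesgue_measurable_stripe j : lebesgue_measurable (stripe j).
Proof. exact: (@lebesgue_measurable_ceil_sum R d (fun z => (m %| z + j)%Z)). Qed.

Lemma lebesgue_measurable_stripeC j : lebesgue_measurable (~` stripe j).
Proof.
exact/(@caratheodory_measurable_setC _ _ (@lebesgue_Rd R d.+1))/lebesgue_measurable_stripe.
Qed.

(** The [m] stripes split [X] measurably, so their traces have total measure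
    that of [X]; passing to complements multiplies it by m - 1. *)
Lemma sum_stripes X x s V : 0 <= s -> 0 <= V -> X `<=` halo x s V ->
  \sum_(j < m) fine (lebesgue_Rd (X `&` ~` stripe j)) =
  (m%:R - 1) * fine (lebesgue_Rd X).
Proof.
move=> s0 V0 XH.
have fin Y : Y `<=` X -> lebesgue_Rd Y = (fine (lebesgue_Rd Y))%:E.
  by move=> YX; apply: (lebesgue_Rd_sub_halo s0 V0); exact: subset_trans XH.
pose A n := if (n < m)%N then stripe n else set0.
have mA n : lebesgue_measurable (A n).
  rewrite /A; case: ifP => _; first exact: lebesgue_measurable_stripe.
  exact: (caratheodory_measurable_set0 (@lebesgue_Rd R d.+1)).
have tA : trivIset setT A.
  apply/trivIsetP => i j _ _ ij; rewrite /A -subset0.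
  case: ifP => im; case: ifP => jm; rewrite ?set0I ?setI0// => y [] /= yi yj.
  have : (m %| i%:Z - j%:Z)%Z.
    have -> : i%:Z - j%:Z = ceil_sum y + i - (ceil_sum y + j) by ring.
    exact: rpredB.
  by rewrite -eqz_mod_dvd !modz_small ?ltz_nat ?im ?jm//= => /eqP[/eqP]; apply/negP.
have cA : \big[setU/set0]_(i < m) A i = setT.
  apply/seteqP; split=> // y _; rewrite -bigcup_mkord.
  have mz : m%:Z != 0 by rewrite -lt0n.
  have lt0 := modz_ge0 (- ceil_sum y) mz.
  have ltm : (- ceil_sum y %% m < m)%Z by rewrite ltz_pmod.
  exists `|(- ceil_sum y %% m)%Z|%N => /=; first lia.
  rewrite /A ifT; last lia.
  rewrite /stripe /= gez0_abs// -{1}[ceil_sum y]opprK addrC -eqz_mod_dvd.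
  by rewrite modz_mod.
have tot : fine (lebesgue_Rd X) = \sum_(j < m) fine (lebesgue_Rd (X `&` stripe j)).
  have := @caratheodory_additive _ _ (@lebesgue_Rd R d.+1) A mA tA m X.
  rewrite cA setIT (eq_bigr (fun j : 'I_m =>
    (fine (lebesgue_Rd (X `&` stripe j)))%:E)).
    by rewrite sumEFin => ->.
  by move=> j _; rewrite /A ltn_ord -fin//; exact: subIsetl.
have part j : fine (lebesgue_Rd (X `&` ~` stripe j)) =
    fine (lebesgue_Rd X) - fine (lebesgue_Rd (X `&` stripe j)).
  have := lebesgue_measurable_stripe j X.
  rewrite (fin X)// (fin (X `&` stripe j)); last exact: subIsetl.
  rewrite (fin (X `&` ~` stripe j)); last exact: subIsetl.
  by rewrite -EFinD => -[->]; rewrite addrC addKr.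
under eq_bigr do rewrite part.
rewrite sumrB -tot sumr_const card_ord -mulr_natl; ring.
Qed.

Let shift (j : nat) : 'rV[R]_d.+1 := j%:R *: delta_mx ord0 ord0.

Lemma stripe_shift j x : stripe 0 (x + shift j) = stripe j x.
Proof.
by rewrite /stripe /shift /= -[j%:R]/(j%:Z%:~R) ceil_sum_shift addr0.
Qed.

Let shift_lt j i : (j < m)%N -> `|shift j ord0 i| < m%:R + 1.
Proof.
move=> jm; rewrite !mxE /=; case: eqP => _; rewrite ?mulr1 ?mulr0 ?normr0; last by rewrite ltr_wpDl.
by rewrite normr_nat natr1 ltr_nat ltnS ltnW.
Qed.

(** All the translates of the trace on the cube by - j e_0, j < m, lie in the halo
    and outside the j-th stripe; [sum_stripes] on the halo averages these [m]
    upper bounds. *)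
Lemma stripeC_cube_le x s : 0 < s ->
  (lebesgue_Rd (~` stripe 0 `&` cube x s) <=
   ((1 - m%:R^-1) * (s + 2 * (m%:R + 1)) ^+ d.+1)%:E)%E.
Proof.
move=> s0; set V : R := m%:R + 1; have V0 : 0 < V by rewrite ltr_wpDl.
have mR : 0 < m%:R :> R by rewrite ltr0n.
pose H := halo x s V.
have := @sum_stripes H x s V (ltW s0) (ltW V0) (@subset_refl _ _).
rewrite (lebesgue_Rd_halo x (ltW s0) (ltW V0)) /=; set W := (_ ^+ d.+1) => tot.
set Y := _ `&` _.
have YH : Y `<=` halo x s V by move=> y [_ /(cube_halo V0)].
rewrite (lebesgue_Rd_sub_halo (ltW s0) (ltW V0) YH) lee_fin.
have le j : (j < m)%N -> fine (lebesgue_Rd Y) <= fine (lebesgue_Rd (H `&` ~` stripe j)).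
  move=> jm; rewrite -lee_fin -(lebesgue_Rd_sub_halo (ltW s0) (ltW V0) YH).
  rewrite -(lebesgue_Rd_sub_halo (ltW s0) (ltW V0) (@subIsetl _ _ _)).
  apply: le_trans (lebesgue_Rd_translate _ (- shift j)) _.
  apply: le_lebesgue_Rd => _ [y [yE yQ] <-]; split.
    apply: (@cube_translate_halo _ _ x s V (- shift j)); last by exists y.
    by move=> i; rewrite mxE normrN shift_lt.
  by rewrite /= -stripe_shift subrK.
have : m%:R * fine (lebesgue_Rd Y) <= (m%:R - 1) * W.
  rewrite -tot mulr_natl -[X in _ *+ X](card_ord m) -sumr_const.
  by apply: ler_sum => j _; exact: le.
rewrite -ler_pdivlMl// => /le_trans; apply.
by rewrite mulrA mulrBr mulr1 mulVf// gt_eqF.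
Qed.

(** By [sum_stripes] on one cube, the complements of the [m] stripes have mean
    relative measure 1 - 1/m in it; the best of them is the trace of the
    complement of the stripe 0 on a translate of the cube. *)
Lemma stripeC_cube_ge s : 0 < s -> exists x,
  (((1 - m%:R^-1) * s ^+ d.+1)%:E <= lebesgue_Rd (~` stripe 0 `&` cube x s))%E.
Proof.
move=> s0; apply: contrapT => /forallNP lt.
pose Q : set 'rV[R]_d.+1 := cube 0 s.
have mR : 0 < m%:R :> R by rewrite ltr0n.
have QH : Q `<=` halo 0 s 1 by exact: cube_halo.
have fin Y : Y `<=` Q -> lebesgue_Rd Y = (fine (lebesgue_Rd Y))%:E.
  by move=> YQ; apply: (lebesgue_Rd_sub_halo (ltW s0) ler01); exact: subset_trans QH.
have tot := sum_stripes (ltW s0) ler01 QH.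
have Qge : s ^+ d.+1 <= fine (lebesgue_Rd Q).
  by rewrite -lee_fin -fin//; exact: lebesgue_Rd_cube_ge (ltW s0).
have small j : fine (lebesgue_Rd (Q `&` ~` stripe j)) < (1 - m%:R^-1) * s ^+ d.+1.
  rewrite -lte_fin -fin; last exact: subIsetl.
  apply: le_lt_trans (lebesgue_Rd_translate _ (shift j)) _.
  have /negP := lt (shift j); rewrite -ltNge; apply: le_lt_trans.
  apply: le_lebesgue_Rd => _ [y [yQ nyE] <-]; split.
    by rewrite /= stripe_shift.
  by move=> i; have := yQ i; rewrite !mxE; lra.
have : \sum_(j < m) fine (lebesgue_Rd (Q `&` ~` stripe j)) <
    \sum_(j < m) (1 - m%:R^-1) * s ^+ d.+1.
  apply: ltr_sum => //.
  by apply/hasP; exists (Ordinal m0); rewrite ?mem_index_enum.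
rewrite tot sumr_const card_ord -[X in _ < X]mulr_natl [X in _ < X]mulrA mulrBr mulr1 mulfV ?gt_eqF//.
apply/negP; rewrite -leNgt ler_wpM2l// subr_ge0 ler1n//.
Qed.

Lemma upper_banach_density_stripeC :
  upper_banach_density (~` stripe 0) = (1 - m%:R^-1)%:E.
Proof.
have c0 : 0 <= 1 - m%:R^-1 :> R by rewrite subr_ge0 invf_le1 ?ler1n ?ltr0n.
apply/cvg_lim => //.
apply: (@squeeze_cvge _ _ _ _ (fun=> (1 - m%:R^-1)%:E) _
  (fun s : R => ((1 - m%:R^-1) * (1 + 2 * (m%:R + 1) / s) ^+ d.+1)%:E)).
- near=> s; have s0 : 0 < s by near: s; exact: nbhs_pinfty_gt.
  have sD : 0 < s ^+ d.+1 by rewrite exprn_gt0.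
  apply/andP; split.
    have [x xge] := stripeC_cube_ge s0.
    apply: le_ereal_sup_tmp; eexists; first by exists x.
    by rewrite lee_pdivlMr.
  apply: ge_ereal_sup => _ [x _ <-]; rewrite lee_pdivrMr// -EFinM.
  apply: le_trans (stripeC_cube_le x s0) _.
  rewrite lee_fin -[X in _ <= X]mulrA -exprMn.
  suff -> : (1 + 2 * (m%:R + 1) / s) * s = s + 2 * (m%:R + 1) by [].
  by field; rewrite gt_eqF.
- exact: cvg_cst.
- apply/fine_cvgP; split; first by near=> s.
  rewrite -[X in _ --> X]mulr1.
  by apply: cvgM; [exact: cvg_cst|exact: cvg_pow_ratio].
Unshelve. all: by end_near. Qed.

End Stripes.

(** * A rigid configuration avoided by the periodic set *)

Section RigidConfiguration.
Variables (R : realType) (d m : nat).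

(** The first [m] points are the progression - e_0, 0, ..., (m - 2) e_0, which
    for m > 2 already contains e_0 and - e_0; the remaining ones list e_i and - e_i in
    consecutive places for each i > 0, the parity giving the sign. *)
Definition rigid_point (k : nat) : 'rV[R]_d.+1 :=
  if (k < m)%N then (k%:R - 1) *: delta_mx ord0 ord0
  else (-1) ^+ (k - m) *: delta_mx ord0 (inord (k - m)./2.+1).

Definition rigid_configuration : set 'rV[R]_d.+1 :=
  rigid_point @` `I_(m + d.*2).

Lemma rigid_point_axis k : (m <= k < m + d.*2)%N ->
  exists2 i : 'I_d, rigid_point k = (-1) ^+ (k - m) *: delta_mx ord0 (lift ord0 i)
    & i = (k - m)./2 :> nat.
Proof.
move=> /andP[mk kn].
have lt : ((k - m)./2 < d)%N by lia.
exists (Ordinal lt) => //; rewrite /rigid_point ltnNge mk /=; congr (_ *: delta_mx _ _).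
by apply/val_inj; rewrite /= inordK// ltnS.
Qed.

Lemma rigid_point_inj k l : (k < m + d.*2)%N -> (l < m + d.*2)%N ->
  rigid_point k = rigid_point l -> k = l.
Proof.
wlog kl : k l / (k <= l)%N.
  move=> H kn ln E; have [kl|lk] := leqP k l; first exact: H.
  by apply/esym/H => //; exact: ltnW.
move=> kn ln; have [lm|ml] := ltnP l m.
  rewrite /rigid_point lm (leq_ltn_trans kl lm) => /rowP/(_ ord0).
  rewrite !mxE !eqxx !mulr1 => /addIr/eqP; rewrite eqr_nat => /eqP//.
have [|j -> jl] := @rigid_point_axis l; first by rewrite ml ln.
have sgn0 (e : nat) : (-1) ^+ e != 0 :> R by rewrite signr_eq0.
have [km|mk] := ltnP k m.
  rewrite /rigid_point km => /rowP/(_ (lift ord0 j)).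
  by rewrite !mxE !eqxx /= mulr0 mulr1 => /esym/eqP; rewrite (negbTE (sgn0 _)).
have [|i -> ik] := @rigid_point_axis k; first by rewrite mk kn.
move=> /rowP/(_ (lift ord0 j)); rewrite !mxE !eqxx /= mulr1 (inj_eq lift_inj).
have [ji|_] := eqVneq j i; last by rewrite mulr0 => /esym/eqP; rewrite (negbTE (sgn0 _)).
rewrite mulr1 => /eqP; rewrite -signr_odd -[eqbRHS]signr_odd.
rewrite (inj_eq (@signr_inj R)) => /eqP odds.
have : (k - m)./2 = (l - m)./2 by rewrite -ik -jl ji.
move: (odd_double_half (k - m)) (odd_double_half (l - m)); rewrite odds; lia.
Qed.

Lemma rigid_configuration_card : configuration (m + d.*2) rigid_configuration.
Proof.
apply: inj_card_eq => k l; rewrite !inE /=; exact: rigid_point_inj.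
Qed.

Lemma rigid_configuration_ap k : (k < m)%N ->
  rigid_configuration ((k%:R - 1) *: delta_mx ord0 ord0).
Proof.
by move=> km; exists k => /=; [rewrite ltn_addr|rewrite /rigid_point km].
Qed.

Hypothesis m3 : (2 < m)%N.

Lemma rigid_configuration_sign (b : bool) (i : 'I_d.+1) :
  rigid_configuration ((-1) ^+ b *: delta_mx ord0 i).
Proof.
have off_axis (j : 'I_d) : rigid_configuration ((-1) ^+ b *: delta_mx ord0 (lift ord0 j)).
  have jd := ltn_ord j.
  have e : (m + j.*2 + b - m = b + j.*2)%N by lia.
  exists (m + j.*2 + b)%N => /=; first by case: b {e} => /=; lia.
  have [|i' -> i'E] := @rigid_point_axis (m + j.*2 + b); first by case: b {e} => /=; lia.
  have -> : i' = j by apply/val_inj; rewrite /= i'E e half_bit_double.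
  by rewrite e -signr_odd oddD odd_double addbF oddb.
case: (unliftP ord0 i) => [j|] ->; first exact: off_axis.
case: b {off_axis} => /=.
  have := @rigid_configuration_ap 0; rewrite sub0r; apply; lia.
have := @rigid_configuration_ap 2; rewrite expr0.
have -> : 2 - 1 = 1 :> R by lra.
by apply.
Qed.

(** The dilation factor is taken to be an arbitrarily large integer [N] that is 1
    modulo [m]. The image of the progression is then an axis progression with step
    N or - N, along which [ceil_sum] runs through all residues modulo [m]. *)
Lemma stripeC_avoids_rigid (p : R) : 1 < p -> p != 2 ->
  ~ contains_large_dilates (m + d.*2) p (~` @stripe R d m 0).
Proof.
move=> p1 p2 /(_ _ rigid_configuration_card)[r0 r00 large].
pose N := (m * Num.bound r0).+1; pose r : R := N%:R.
have rpos : 0 < r by rewrite ltr0n.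
have r0r : r0 <= r.
  apply: le_trans (ltW (archi_boundP (ltW r00))) _.
  by rewrite ler_nat /N; apply/leqW/leq_pmull; lia.
have [Y [phi [bij iso]] YE] := large _ r0r.
have P0 : rigid_configuration 0.
  have := @rigid_configuration_ap 1; rewrite subrr scale0r; apply; lia.
have Pe i : rigid_configuration (delta_mx ord0 i).
  by have := rigid_configuration_sign false i; rewrite expr0 scale1r.
have Pn i : rigid_configuration (- delta_mx ord0 i).
  by have := rigid_configuration_sign true i; rewrite expr1 scaleN1r.
have [t [c [cr ap]]] := lp_copy_axis p1 p2 rpos iso P0 Pe Pn rigid_configuration_ap.
(* The sign of the step is kept as an integer [e] with e * e = 1. *)
have [e [e1 cE]] : exists e : int, e * e = 1 /\ c = (e * N)%:~R.
  have [c0|c0] := leP 0 c.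
    by exists 1; rewrite !mul1r; split=> //; rewrite -(ger0_norm c0) cr.
  by exists (-1); rewrite mulrNN mulr1 mulN1r; split=> //; rewrite rmorphN -[RHS]/(- r) -cr ltr0_norm ?opprK.
pose S := ceil_sum (phi 0).
have mz : m%:Z != 0 by lia.
(* The term of index [k] is phi 0 + (k - 1) e N e_t, of value
   S + (k - 1) e modulo m; this index makes it vanish. *)
pose k := `|((1 - e * S) %% m)%Z|%N.
have kE : k%:Z = ((1 - e * S) %% m)%Z by rewrite gez0_abs// modz_ge0.
have km : (k < m)%N by rewrite -ltz_nat kE ltz_pmod//; lia.
have Yk : Y (phi ((k%:R - 1) *: delta_mx ord0 ord0)).
  by have [+ _ _] := bij; apply; exact: rigid_configuration_ap.
apply: (YE _ Yk); rewrite (ap _ km).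
have -> : (k%:R - 1) * c = ((k%:Z - 1) * (e * N))%:~R :> R.
  by rewrite cE [in RHS]intrM rmorphB.
rewrite /stripe /= ceil_sum_shift addr0 -/S.
have -> : (k%:Z - 1) = (k%:Z - (1 - e * S)) - e * S by ring.
have -> : S + (k%:Z - (1 - e * S) - e * S) * (e * N) =
    (k%:Z - (1 - e * S)) * (e * N) + S * (1 - e * e * N) by ring.
apply: rpredD.
  by rewrite dvdz_mulr// -eqz_mod_dvd kE modz_mod.
rewrite e1 mul1r dvdz_mull//.
have -> : 1 - N%:Z = m%:Z * - (Num.bound r0)%:Z by rewrite /N -addn1 PoszD PoszM; ring.
exact: dvdz_mulr.
Qed.

End RigidConfiguration.

(** * The threshold density *)

Section Threshold.
Variables (R : realType) (d : nat).

(** Translates of the dilated configuration suffice, for every factor r >= 1. *)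
Lemma admissible_pigeonhole (n : nat) (p : R) : (0 < n)%N -> 1 < p ->
  admissible_densities d.+1 n p (1 - n%:R^-1).
Proof.
move=> n0 p1; have n1 : n%:R^-1 <= 1 :> R by rewrite invf_le1 ?ltr0n ?ler1n.
have ni : 0 <= n%:R^-1 :> R by rewrite invr_ge0.
split=> [|E mE dens P]; first by lra.
rewrite /configuration card_eq_sym => /card_set_bijP[q [qP _ qsurj]].
exists 1 => // r r1; have r0 : 0 < r by lra.
have [t tE] := @dense_translate _ _ n E (fun k => r *: q k) n0 mE dens.
exists ((fun u => t + r *: u) @` P).
  exists (fun u => t + r *: u); split.
    split=> [u Pu|u v _ _ /addrI/(scalerI (lt0r_neq0 r0))|]//; by exists u.
  move=> u v _ _; rewrite opprD addrACA subrr add0r -scalerBr lp_norm_scale ?ltW//.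
  by rewrite gt_eqF// (lt_trans ltr01).
by move=> _ [u Pu <-]; have [k kn <-] := qsurj _ Pu; exact: tE.
Qed.

Lemma admissible_ge (m : nat) (p rho : R) : (2 < m)%N -> 1 < p -> p != 2 ->
  admissible_densities d.+1 (m + d.*2) p rho -> 1 - m%:R^-1 <= rho.
Proof.
move=> m3 p1 p2 [_ adm]; rewrite leNgt; apply/negP => lt.
have m0 : (0 < m)%N by lia.
apply: (@stripeC_avoids_rigid R d m m3 p p1 p2); apply: adm.
  exact: lebesgue_measurable_stripeC.
by rewrite upper_banach_density_stripeC// lte_fin.
Qed.

(** The defining strict inequality on densities is an open condition on the
    threshold, so it passes to the infimum. *)
Lemma is_rho_min_inf (n : nat) (p : R) : admissible_densities d n p !=set0 ->
  is_rho_min d n p (inf (admissible_densities d n p)).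
Proof.
move=> [a Aa]; set A := admissible_densities d n p.
have lb : has_lbound A by exists 0 => x [/andP[]].
have hi : has_inf A by split=> //; exists a.
split; last by move=> x Ax; exact: ge_inf.
split=> [|E mE dens].
  apply/andP; split; first by apply: lb_le_inf => [|x [/andP[]]]; first by exists a.
  by apply: le_trans (ge_inf lb Aa) _; have [/andP[]] := Aa.
have [b [[_ bE] ltb]] : exists b, A b /\ (b%:E < upper_banach_density E)%E.
  move: dens; case: (upper_banach_density E) => [l| |//].
    by rewrite lte_fin => /(inf_lt hi.1)[b Ab bl]; exists b; rewrite lte_fin.
  by move=> _; exists a; split=> //; rewrite ltry.
exact: bE.
Qed.

End Threshold.

Theorem corollary4 (R : realType) (d : nat) (hd : (0 < d)%N) :
  exists C : R, forall (n : nat) (p : R), (0 < n)%N -> 1 < p -> p != 2 ->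
    exists2 rho : R, is_rho_min d n p rho &
      `|rho - (1 - n%:R^-1)| <= C / n%:R ^+ 2.
Proof.
case: d hd => // d _; exists (16 * d.+1%:R ^+ 2) => n p n0 p1 p2.
have adm := admissible_pigeonhole d n0 p1.
have := is_rho_min_inf (ex_intro _ _ adm); set rho := inf _ => rhoP.
exists rho => //; have [rho_adm rho_lb] := rhoP.
have nR : 0 < n%:R :> R by rewrite ltr0n.
have le_rho : rho <= 1 - n%:R^-1 := rho_lb _ adm.
rewrite ler0_norm ?subr_le0// ler_pdivlMr ?exprn_gt0//.
have dR : 0 <= d%:R :> R by [].
(* For small n the constant exceeds n ^ 2, and the error is at most 1. *)
rewrite -natr1; have [nd|nd] := leqP n (4 * d.+1).
  have [/andP[rho0 _] _] := rho_adm.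
  have nd' : n%:R <= 4 * (d%:R + 1) :> R by rewrite natr1 -natrM ler_nat.
  have n1 : 0 <= n%:R^-1 :> R by rewrite invr_ge0.
  apply: (@le_trans _ _ (1 * n%:R ^+ 2)); first by rewrite ler_wpM2r ?exprn_ge0//; lra.
  by nra.
have [m m3 nE] : exists2 m, (2 < m)%N & n = (m + d.*2)%N by exists (n - d.*2)%N; lia.
have mR : 0 < m%:R :> R by rewrite ltr0n; lia.
have rho_adm2 : admissible_densities d.+1 (m + d.*2) p rho by rewrite -nE.
have ge_rho := admissible_ge m3 p1 p2 rho_adm2.
apply: (@le_trans _ _ ((m%:R^-1 - n%:R^-1) * n%:R ^+ 2)).
  by rewrite ler_wpM2r ?exprn_ge0//; lra.
have nmd : n%:R = m%:R + 2 * d%:R :> R by rewrite nE natrD -mul2n natrM.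
have nm : n%:R <= 2 * m%:R :> R by rewrite -natrM ler_nat; lia.
have -> : (m%:R^-1 - n%:R^-1) * n%:R ^+ 2 = 2 * d%:R * (n%:R / m%:R) :> R.
  by rewrite nmd; field; rewrite gt_eqF// -nmd gt_eqF.
have : n%:R / m%:R <= 2 :> R by rewrite ler_pdivrMr.
have : 0 <= n%:R / m%:R :> R by rewrite divr_ge0.
nra.
Qed.
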